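(* Let $\Delta\ge1$ be an integer and let $G=(V,E)$ be an $n$-vertex, unweighted, undirected graph whose edges are colored so that every color class has at most $\Delta$ edges. Then there is a $1$-CFT $+2$-spanner $H\subseteq G$ with \[ |E(H)| = O\big(n^{2-1/(\Delta+2)} \cdot \Delta\, (\log n)^{1-1/(\Delta+2)}\big). \]
   Context: An edge-colored graph assigns each edge exactly one color, with no restrictions; a color class is the set of edges of one color. For a color $c$, $G-c$ denotes $G$ with all edges of color $c$ deleted, and $\operatorname{dist}_G(u,v\mid c)$ is the distance from $u$ to $v$ in $G-c$. A subgraph $H\subseteq G$ is a $1$-CFT $+2$-spanner if for every color $c$ and all $u,v\in V$, $\operatorname{dist}_H(u,v\mid c)\le \operatorname{dist}_G(u,v\mid c)+2$. *)

(* Defs.v *)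
From HB Require Import structures.
From mathcomp Require Import all_boot all_order all_algebra.
From mathcomp Require Import all_classical all_reals all_analysis.

Set Implicit Arguments.
Unset Strict Implicit.
Unset Printing Implicit Defensive.

Import Order.TTheory GRing.Theory Num.Theory.

Local Open Scope ring_scope.

(* A graph on the vertex set [V] is given by its edge set [E : {set {set V}}];
   [simple_graph E] makes it undirected and loopless.  Since every subgraph
   considered has the same vertex set, subgraphs are subsets of [E]. *)
Definition simple_graph (V : finType) (E : {set {set V}}) : Prop :=
  forall e, e \in E -> #|e| = 2%N.

Definition adj (V : finType) (E : {set {set V}}) : rel V :=
  fun x y => [set x; y]%SET \in E.

(* [path (adj E) u p] says that [u :: p] is a walk, whose length is [size p].
   The infimum over no walk at all is [+oo]. *)
Definition dist (R : realType) (V : finType) (E : {set {set V}}) (u v : V) :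
    \bar R :=
  ereal_inf [set ((size p)%:R)%:E | p in
    [set p : seq V | path (adj E) u p /\ last u p = v]]%classic.

(* A coloring is a function on all sets of vertices; only its values on edges
   matter.  The palette [K] is arbitrary. *)
Definition color_class (V : finType) (K : eqType) (E : {set {set V}})
    (col : {set V} -> K) (c : K) : {set {set V}} :=
  [set e in E | col e == c]%SET.

Definition delete_color (V : finType) (K : eqType) (E : {set {set V}})
    (col : {set V} -> K) (c : K) : {set {set V}} :=
  (E :\: color_class E col c)%SET.

Definition dist_avoiding (R : realType) (V : finType) (K : eqType)
    (E : {set {set V}}) (col : {set V} -> K) (c : K) (u v : V) : \bar R :=
  dist R (delete_color E col c) u v.

Definition one_CFT_plus2_spanner (R : realType) (V : finType) (K : eqType)
    (E : {set {set V}}) (col : {set V} -> K) (H : {set {set V}}) : Prop :=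
  H \subset E /\
  forall (c : K) (u v : V),
    (dist_avoiding R H col c u v <= dist_avoiding R E col c u v + 2%:E)%E.

(* Main.v *)
(* Let q be about (n log n)^(1/(Delta+2)) and L_j = q^(Delta+1-j).  Greedily pick
   sets S_0, ..., S_Delta of at most q^(j+1) vertices, where S_j meets every
   neighborhood in some G - c of size at least L_j and the L_j vertices closest
   to t on the chosen shortest s-t path of G - c, for all s, t, c.
   The spanner keeps all edges at vertices of degree below L_0 + Delta and, for
   every t and every s in S_j, the edge at t of the shortest s-t path in G, and
   of the one in G - c for each color c among the last L_{j+1} edges of the former.
   This is at most 2 q^(Delta+1) edges for each j and t.
   Distances from S_0 are preserved exactly: if the rule for s_j in S_j
   provides no good edge at t, then c occurs on the s_j-t path of G, at distance
   at least L_{j+1} from t, and S_{j+1} hits the end of the s_j-t path of G - c in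
   some s_{j+1} at distance at most L_{j+1} from t; since the c-edges found in
   this way come closer and closer to t, they are distinct, and there are at most
   Delta of them.  A missing edge has an end x of large degree, and rerouting
   through a neighbor of x in S_0 costs at most 2.
   When (n log n)^(1/(Delta+2)) is below Delta + 2, the bound is of order n^2 and
   the whole graph will do; otherwise rounding q up costs a factor e only. *)

Require Import Defs.
From HB Require Import structures.
From mathcomp Require Import all_classical all_reals all_analysis.
From mathcomp Require Import all_boot all_order all_algebra.
From mathcomp Require Import zify ring lra.

Set Implicit Arguments.
Unset Strict Implicit.
Unset Printing Implicit Defensive.

Import Order.TTheory GRing.Theory Num.Theory.

Local Open Scope ring_scope.

(** * Walks of bounded length and shortest paths *)

Section Walks.
Local Open Scope nat_scope.
Variable V : finType.
Implicit Types (F : {set {set V}}) (p : seq V) (u v t x : V).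

Definition walk F u v k :=
  exists p, [/\ path (adj F) u p, last u p = v & size p <= k].

Lemma adj_sym F : symmetric (adj F).
Proof. by move=> x y; rewrite /adj setUC. Qed.

Lemma walk_refl F u k : walk F u u k.
Proof. by exists [::]. Qed.

Lemma walk_edge F u v : adj F u v -> walk F u v 1.
Proof. by move=> uv; exists [:: v]; rewrite /= uv. Qed.

Lemma walk_path {F u p} : path (adj F) u p -> walk F u (last u p) (size p).
Proof. by move=> up; exists p. Qed.

Lemma walk_cat {F u v x k l} : walk F u v k -> walk F v x l -> walk F u x (k + l).
Proof.
move=> [p [up <- pk]] [r [vr <- rl]]; exists (p ++ r).
by rewrite cat_path up vr last_cat size_cat leq_add.
Qed.

Lemma walk_le {F u v k l} : walk F u v k -> k <= l -> walk F u v l.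
Proof. by move=> [p [up uv pk]] kl; exists p; split=> //; exact: leq_trans kl. Qed.

Lemma walk_sub {F F' u v k} : F \subset F' -> walk F u v k -> walk F' u v k.
Proof.
move=> /subsetP FF' [p [up uv pk]]; exists p; split=> //.
by apply: sub_path up => x y; exact: FF'.
Qed.

Lemma walk_sym {F u v k} : walk F u v k -> walk F v u k.
Proof.
move=> [p [up <- pk]]; exists (rev (belast u p)); split.
- by rewrite rev_path (eq_path (e' := adj F)) // => x y; exact: adj_sym.
- by case: p {up pk} => //= x p; rewrite rev_cons last_rcons.
- by rewrite size_rev size_belast.
Qed.

(** Fixing one shortest path per pair leaves only polynomially many paths to hit. The default [[::]]
    stands for an unreachable target. *)
Definition geodesic F u v : seq V := xget [::]
  (fun p => [/\ path (adj F) u p, last u p = v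
           & forall k, walk F u v k -> size p <= k]).

Lemma geodesicP {F u v k} : walk F u v k ->
  [/\ path (adj F) u (geodesic F u v), last u (geodesic F u v) = v
    & forall l, walk F u v l -> size (geodesic F u v) <= l].
Proof.
move=> w; rewrite /geodesic; case: xgetP => [p _ //|noP].
have ex : exists l, `[< walk F u v l >] by exists k; apply/asboolP.
case: (ex_minnP ex) => m /asboolP[p [up uv pm]] mmin.
case: (noP p); split=> // l wl.
by apply: leq_trans pm _; apply: mmin; apply/asboolP.
Qed.

(** Removing repetitions cannot shorten a shortest path. Thus the first [l] vertices of a long
    enough geodesic form a set of size [l]. *)
Lemma geodesic_uniq {F u v k} : walk F u v k -> uniq (u :: geodesic F u v).
Proof.
move=> /geodesicP[]; move: (geodesic _ _ _) => p up uv pmin.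
move: uv; case/shortenP: up => p' up' unip' sp' uv.
apply: (leq_size_uniq unip') => [x|].
  by rewrite !inE => /orP[->//|/sp' ->]; rewrite orbT.
by rewrite /= ltnS; apply: pmin; exists p'.
Qed.

Definition path_edges u p : seq {set V} := pairmap (fun a b => [set a; b]) u p.

Lemma path_edgesP F u p :
  reflect {subset path_edges u p <= F} (path (adj F) u p).
Proof.
apply: (iffP idP) => [|sub].
  elim: p u => [|x p IHp] u //= /andP[ux xp] e; rewrite inE => /orP[/eqP->//|].
  exact: IHp.
elim: p u sub => [|x p IHp] u //= sub; apply/andP; split.
  by apply: sub; rewrite inE eqxx.
by apply: IHp => e ep; apply: sub; rewrite inE ep orbT.
Qed.

Lemma mem_drop_path_edges l u p e : e \in drop l (path_edges u p) ->
  exists p1 b p2, [/\ p = p1 ++ b :: p2, e = [set last u p1; b] & l <= size p1].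
Proof.
elim: p l u => [|x p IHp] [|l] u //=; last first.
  by move=> /IHp[p1 [b [p2 [-> -> lp]]]]; exists (x :: p1), b, p2.
rewrite inE => /orP[/eqP->|ep]; first by exists [::], x, p.
have [|p1 [b [p2 [-> -> lp]]]] := IHp 0 x; first by rewrite drop0.
by exists (x :: p1), b, p2.
Qed.

(** A shorter route to the end of [p1] would shorten the whole path. Only sizes are compared, as the
    geodesic chosen for that end may differ from [p1]. *)
Lemma size_geodesic_prefix {F u v k p1 p2} : walk F u v k ->
  geodesic F u v = p1 ++ p2 -> size (geodesic F u (last u p1)) = size p1.
Proof.
move=> w; have [up uv pmin] := geodesicP w => def_p.
move: up uv pmin; rewrite def_p cat_path last_cat => /andP[up1 up2] uv pmin.
have [_ _ min1] := geodesicP (walk_path up1).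
apply/eqP; rewrite eqn_leq min1 /=; last exact: walk_path.
have [g1 g2 _] := geodesicP (walk_path up1).
have := walk_path g1; rewrite g2 => w1.
have := walk_path up2; rewrite uv => w2.
have := pmin _ (walk_cat w1 w2); by rewrite size_cat leq_add2r.
Qed.

(** Positions on a shortest path are distances from [u]; the end of [e] nearer to [u] is the
    strictly closer [x]. *)
Lemma geodesic_depth F u v l e k : walk F u v k ->
  e \in drop l (path_edges u (geodesic F u v)) ->
  (forall x, x \in e -> l <= size (geodesic F u x)) /\
  exists2 x, x \in e & size (geodesic F u x) < size (geodesic F u v).
Proof.
move=> w /mem_drop_path_edges[p1 [b [p2 [def_p -> lp]]]].
have s1 := size_geodesic_prefix w def_p.
have def_p' : geodesic F u v = rcons p1 b ++ p2 by rewrite cat_rcons.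
have := size_geodesic_prefix w def_p'; rewrite last_rcons size_rcons => s2.
split=> [x|]; first by rewrite !inE => /orP[]/eqP->; rewrite ?s1 ?s2 // leqW.
exists (last u p1); first by rewrite !inE eqxx.
by rewrite s1 def_p size_cat /= addnS ltnS leq_addr.
Qed.

Definition first_edge u p : {set V} := [set u; head u p].

End Walks.

(** * Exact preservation of distances to [S 0] *)

Section Preserver.
Local Open Scope nat_scope.
Variables (V : finType) (K : eqType) (E H : {set {set V}}) (col : {set V} -> K).
Variables (Delta : nat) (S : nat -> {set V}) (L : nat -> nat).
Implicit Types (t s r : V) (c : K).

(* Geodesics are directed from the target [t] to the source [s]: one edge at [t]
   for the fault-free geodesic and one for each color seen among its [l] edges
   closest to [t]. *)
Definition first_edges t s l : seq {set V} :=
  first_edge t (geodesic E t s) ::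
  [seq first_edge t (geodesic (delete_color E col (col e)) t s)
     | e <- take l (path_edges t (geodesic E t s))].

Hypothesis class_le : forall c, #|color_class E col c| <= Delta.
Hypothesis S_hits : forall j t s c k, j <= Delta ->
  walk (delete_color E col c) t s k ->
  let p := geodesic (delete_color E col c) t s in
  L j <= size p -> exists2 x, x \in S j & x \in take (L j) p.
Hypothesis first_edges_H : forall j t s e, j <= Delta -> s \in S j ->
  e \in first_edges t s (L j.+1) -> e \in E -> e \in H.

Let G c := delete_color E col c.
Let d c t s := size (geodesic (G c) t s).

Lemma delete_colorP (F : {set {set V}}) c e :
  (e \in delete_color F col c) = (e \in F) && (col e != c).
Proof. by rewrite !inE; case: (e \in F); rewrite ?andbF ?andbT. Qed.

Lemma delete_color_sub c : G c \subset E.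
Proof. exact: subsetDl. Qed.

(** Since [k < d c t s], the edge starts a shortest path, and the argument can be repeated from
    [x]. *)
Definition first_step c t s :=
  exists x k, [/\ adj (delete_color H col c) t x, walk (G c) x s k & k < d c t s].

(** The assumptions put [r] on a shortest path of [G c] from [t] to [s], so the first edge of any
    shortest path from [t] to [r] in [G c] will do. [first_edges] contains one unless [c] occurs on
    the fault-free geodesic, but only after its first [L j.+1] edges. *)
Lemma first_step_or_far_edge c t s j r k :
  j <= Delta -> r \in S j -> r != t ->
  walk (G c) t r (d c t r) -> walk (G c) r s k -> d c t r + k <= d c t s ->
  first_step c t s \/ exists2 e, e \in color_class E col c &
    (forall x, x \in e -> L j.+1 <= size (geodesic E t x)) /\
    exists2 x, x \in e & size (geodesic E t x) < d c t r.
Proof.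
move=> jD rS rt wr wrs kle.
have [Pp Pl Pmin] := geodesicP wr.
have wE := walk_sub (delete_color_sub c) wr.
have [pip pil pimin] := geodesicP wE.
have good p : path (adj (G c)) t p -> last t p = r -> size p <= d c t r ->
    first_edge t p \in first_edges t r (L j.+1) -> first_step c t s.
  case: p => [_ /eqP|x p] /=; first by rewrite eq_sym (negPf rt).
  move=> /andP[tx xp] xr sp tH; exists x, (size p + k); split.
  - move: tx; rewrite /adj !delete_colorP => /andP[txE ->]; rewrite andbT.
    exact: first_edges_H tH txE.
  - by have := walk_path xp; rewrite xr => /walk_cat; apply.
  - by apply: leq_trans kle; rewrite -addSn leq_add2r.
have [/hasP[e epi /eqP ce]|/hasPn noc] :=
  boolP (has (fun e => col e == c) (path_edges t (geodesic E t r))); last first.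
  left; apply: (good (geodesic E t r)) => //; last 1 first.
  - exact: mem_head.
  - apply/path_edgesP => e epi; rewrite delete_colorP noc // andbT.
    by move/path_edgesP: pip; apply.
  - exact: pimin.
have /path_edgesP/(_ _ epi) eE := pip.
move: epi; rewrite -{1}(cat_take_drop (L j.+1) (path_edges _ _)) mem_cat.
case/orP => epi.
  left; apply: (good (geodesic (G c) t r)) => //.
  by rewrite inE -ce; apply/orP; right; apply: map_f.
right; exists e; first by rewrite !inE eE ce eqxx.
have [far [x xe xd]] := geodesic_depth wE epi; split=> //.
by exists x => //; apply: leq_trans xd _; exact: pimin.
Qed.

(* [A] collects one edge of color [c] for each earlier stage.  These edges are
   at least as far from [t] as the current source [r], which makes the edge
   found at the next stage a new one. *)
Lemma first_step_stage c t s m j r k (A : {set {set V}}) :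
  j + m = Delta -> r \in S j -> r != t ->
  walk (G c) t r (d c t r) -> walk (G c) r s k -> d c t r + k <= d c t s ->
  A \subset color_class E col c -> #|A| = j ->
  (forall e x, e \in A -> x \in e -> d c t r <= size (geodesic E t x)) ->
  first_step c t s.
Proof.
elim: m j r k A => [|m IHm] j r k A jm rS rt wr wrs kle Asub cardA Afar;
  have jD : j <= Delta by lia.
all: have [//|[e ec [far [x xe xd]]]] :=
  first_step_or_far_edge jD rS rt wr wrs kle.
all: have eA : e \notin A by apply/negP => /Afar/(_ xe); rewrite leqNgt xd.
all: have eAsub : e |: A \subset color_class E col c
  by rewrite subUset Asub andbT sub1set.
  (* Base case: [j = Delta], so [e |: A] would have [Delta + 1] edges of color [c]. *)
  have := leq_trans (subset_leq_card eAsub) (class_le c).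
  by rewrite cardsU1 eA cardA add1n; lia.
(* The end [x] of [e] is at least [L j.+1] away but closer than [r], so the path to [r] in [G c] is
   long enough to be hit by [S j.+1]. *)
have Ld : L j.+1 < d c t r by apply: leq_ltn_trans xd; exact: far.
have jD1 : j.+1 <= Delta by lia.
have [y yS ytake] := S_hits jD1 wr (ltnW Ld).
have uniP := geodesic_uniq wr.
have [Pp Pl Pmin] := geodesicP wr.
have yP := mem_take ytake.
have yt : y != t by apply: contraL yP => /eqP ->; case/andP: uniP.
have [p1 [p2 [defP yl sp1]]] : exists p1 p2, [/\ geodesic (G c) t r = p1 ++ p2,
    last t p1 = y & size p1 <= L j.+1].
  have := cat_take_drop (L j.+1) (geodesic (G c) t r).
  have : size (take (L j.+1) (geodesic (G c) t r)) <= L j.+1.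
    by rewrite size_take; case: ltnP.
  case/splitPr: ytake => q1 q2 sz eqP.
  exists (rcons q1 y), (q2 ++ drop (L j.+1) (geodesic (G c) t r)).
  rewrite last_rcons cat_rcons -cat_cons catA eqP; split=> //.
  by apply: leq_trans sz; rewrite size_rcons size_cat /= addnS ltnS leq_addr.
have dy : d c t y = size p1 by rewrite -yl; exact: (size_geodesic_prefix wr defP).
have dr : d c t r = size p1 + size p2 by rewrite /d defP size_cat.
move: Pp Pl; rewrite defP cat_path last_cat yl => /andP[tp1 yp2] rl.
apply: (IHm j.+1 y (size p2 + k) (e |: A)) => //.
- by rewrite addSnnS.
- by rewrite dy; have := walk_path tp1; rewrite yl.
- by apply: walk_cat wrs; have := walk_path yp2; rewrite rl.
- by rewrite addnA dy -dr.
- by rewrite cardsU1 eA cardA.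
(* The new source [y] is within [L j.+1] of [t], hence no farther than [e]; older edges were already
   at least as far as [r]. *)
- move=> f z /setU1P[->|fA] zf; rewrite dy.
    exact: leq_trans sp1 (far _ zf).
  by apply: leq_trans (Afar _ _ fA zf); rewrite dr leq_addr.
Qed.

(** The stages begin with [r = s] and no collected edge. The step obtained leads to a vertex with a
    shorter walk to [s], and induction on [k] finishes. *)
Lemma preserver c t s k : s \in S 0 -> walk (G c) t s k ->
  walk (delete_color H col c) t s k.
Proof.
move=> sS; elim/ltn_ind: k t => k IHk t w.
have [->|st] := eqVneq s t; first exact: walk_refl.
have [Pp Pl Pmin] := geodesicP w.
have wts : walk (G c) t s (d c t s) by rewrite -{1}Pl; exact: walk_path.
have [|||||x [l [tx xs ls]]] :=
  @first_step_stage c t s Delta 0 s 0 set0 _ sS st wts (walk_refl _ _ _).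
- by [].
- by rewrite addn0.
- exact: sub0set.
- exact: cards0.
- by move=> e x; rewrite inE.
have lk : l < k by apply: leq_trans ls _; exact: Pmin.
exact: walk_le (walk_cat (walk_edge tx) (IHk l lk x xs)) lk.
Qed.

End Preserver.

(** * Additive stretch two through heavy vertices *)

Section Cluster.
Local Open Scope nat_scope.
Variables (V : finType) (K : eqType) (E H : {set {set V}}) (col : {set V} -> K).
Variables (S : {set V}) (Delta l : nat).
Hypothesis class_le : forall c, #|color_class E col c| <= Delta.
Hypothesis HE : H \subset E.

Definition nbhd (F : {set {set V}}) (x : V) : {set V} := [set y | adj F x y].

Hypothesis S_dominates : forall c x,
  l <= #|nbhd (delete_color E col c) x| ->
  exists2 s, s \in S & s \in nbhd (delete_color E col c) x.
Hypothesis light_H : forall x e,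
  #|nbhd E x| < l + Delta -> e \in E -> x \in e -> e \in H.
Hypothesis H_preserves : forall c t s k, s \in S ->
  walk (delete_color E col c) t s k -> walk (delete_color H col c) t s k.

(** The lost neighbors correspond injectively to edges of color [c] at [x]. *)
Lemma nbhd_delete_color c x :
  #|nbhd E x| <= #|nbhd (delete_color E col c) x| + Delta.
Proof.
have -> : nbhd (delete_color E col c) x =
    nbhd E x :\: [set y | [set x; y] \in color_class E col c].
  by apply/setP => y; rewrite !inE /adj !inE.
rewrite -(cardsID [set y | [set x; y] \in color_class E col c] (nbhd E x)).
rewrite addnC leq_add2l; apply: leq_trans (class_le c).
rewrite -(card_in_imset (f := fun y => [set x; y])) => [|y z _ _ eq_xyz].
  by apply/subset_leq_card/subsetP => e /imsetP[y /setIP[_ +] ->]; rewrite inE.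
have := set22 x y; have := set22 x z; rewrite -eq_xyz {2}eq_xyz !inE.
by do 2![case: eqP => [->|_] //=] => // /eqP.
Qed.

Lemma cluster_spanner c u v k : walk (delete_color E col c) u v k ->
  walk (delete_color H col c) u v (k + 2).
Proof.
move=> [p [up uv pk]].
have [/hasP[x xp xheavy]|/hasPn light] :=
  boolP (has (fun x => l + Delta <= #|nbhd E x|) (u :: p)); last first.
  exists p; split=> //; last exact: leq_trans pk (leq_addr _ _).
  have : all (fun x => #|nbhd E x| < l + Delta) (u :: p).
    by apply/allP => x /light; rewrite -ltnNge.
  move=> /andP[]; elim: (p) (u) up => [|y q IHq] x //= /andP[xy yq] lx /andP[ly lq].
  rewrite IHq // andbT; move: xy; rewrite /adj !delete_colorP => /andP[xy ->].
  by rewrite andbT (light_H lx) // set21.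
have [|s sS] := S_dominates (c := c) (x := x).
  by have := nbhd_delete_color c x; lia.
rewrite inE => xs.
case/splitPl: xp up uv pk => p1 p2 xl.
rewrite cat_path last_cat size_cat xl => /andP[up1 xp2] xv pk.
have w1 := walk_path up1; have w2 := walk_path xp2.
rewrite xl in w1; rewrite xv in w2.
(* Both ends are routed to [s] through [x]; the edge from [x] to [s] is paid twice, whence the
   [+ 2]. *)
have us := H_preserves sS (walk_cat w1 (walk_edge xs)).
have vs := H_preserves sS (walk_cat (walk_sym w2) (walk_edge xs)).
by apply: walk_le (walk_cat us (walk_sym vs)) _; lia.
Qed.

Lemma cluster_one_CFT (R : realType) : one_CFT_plus2_spanner R E col H.
Proof.
(* Moving the finite 2 across leaves a bare infimum on the right, bounded walk by walk; with no walk
   there is nothing to check. *)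
split=> // c u v; rewrite -leeBlDr //.
apply: le_ereal_inf_tmp => _ [p [up uv] <-].
rewrite leeBlDr // -EFinD.
have [r [ur rv rp]] := cluster_spanner (ex_intro _ p (And3 up uv (leqnn _))).
apply: (@le_trans _ _ (size r)%:R%:E); last by rewrite lee_fin -natrD ler_nat.
by apply: ereal_inf_lbound; exists r.
Qed.

End Cluster.

(** * Greedy hitting sets *)

Section Hitting.
Local Open Scope nat_scope.
Variable V : finType.
Implicit Types (FF : {set {set V}}) (S A : {set V}).

(** By averaging, some vertex lies in at least a fraction [L / #|V|] of the sets not yet hit, so
    each pick multiplies their number by at most [1 - L / #|V|]; denominators are cleared. *)
Lemma greedy_hitting FF L m : (forall A, A \in FF -> L <= #|A|) ->
  exists2 S : {set V}, #|S| <= m &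
    #|[set A : {set V} in FF | [disjoint S & A]]| * #|V| ^ m <= #|FF| * (#|V| - L) ^ m.
Proof.
move=> FFL; elim: m => [|m [S Sm]].
  exists set0; first by rewrite cards0.
  rewrite !muln1; apply/subset_leq_card/subsetP => A; by rewrite inE => /andP[].
set U := [set A in FF | _] => US.
case: (posnP #|V|) => [V0|V0].
  by exists S; [exact: leqW | rewrite V0 exp0n // muln0].
pose deg x := #|[set A : {set V} in U | x \in A]|.
have [x xmax] : exists x, forall y, deg y <= deg x.
  have [x maxE] := bigop.eq_bigmax deg V0; exists x => y.
  by rewrite -maxE; exact: bigop.leq_bigmax.
have degU : #|U| * L <= #|V| * deg x.
  rewrite -!sum_nat_const.
  apply: (@leq_trans (\sum_(A in U) #|A|)).
    by apply: leq_sum => A; rewrite inE => /andP[/FFL].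
  rewrite (eq_bigr (fun A : {set V} => \sum_(y in V) (y \in A))); last first.
    move=> A _; rewrite -sum1_card big_mkcond.
    by apply: eq_big => // y _; case: (y \in A).
  rewrite exchange_big /=; apply: leq_sum => y _.
  apply: leq_trans (xmax y); rewrite /deg -sum1_card.
  rewrite big_mkcond [leqRHS]big_mkcond; apply: leq_sum => A _.
  by rewrite !inE; case: (A \in FF); case: [disjoint _ & _]; case: (y \in A).
exists (x |: S); first by rewrite cardsU1; case: (x \notin S) => //=; exact: leqW.
set U' := [set A in FF | _].
have U'U : #|U'| + deg x <= #|U|.
  rewrite -(cardsID [set A : {set V} | x \in A] U) addnC leq_add //.
    by apply/subset_leq_card/subsetP => A; rewrite !inE.
  apply/subset_leq_card/subsetP => A; rewrite !inE.
  rewrite (eq_disjoint (B := [predU1 x & S])) => [|y]; last by rewrite !inE.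
  by rewrite disjointU1 => /andP[-> /andP[-> ->]].
have step : #|U'| * #|V| <= #|U| * (#|V| - L).
  have : (#|U'| + deg x) * #|V| <= #|U| * #|V| by rewrite leq_mul2r U'U orbT.
  rewrite mulnBr mulnDl (mulnC (deg x)); move: degU; lia.
rewrite !expnS mulnA mulnCA.
apply: leq_trans (leq_mul step (leqnn _)) _.
by rewrite mulnAC mulnC leq_mul2l US orbT.
Qed.

(** By [1 - x <= expR (- x)], a set missed by [m] greedy picks would force
    [m * L / #|V| <= ln #|FF|]. *)
Lemma hitting_set (R : realType) FF L m : (forall A, A \in FF -> L <= #|A|) ->
  (ln #|FF|%:R * #|V|%:R < (m * L)%:R :> R)%R ->
  exists2 S : {set V}, #|S| <= m & forall A, A \in FF -> exists2 x, x \in S & x \in A.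
Proof.
move=> FFL lnFF; have [S Sm SU] := greedy_hitting m FFL.
exists S => // A AFF; case: (boolP [disjoint S & A]); last first.
  by move=> /pred0Pn[x /andP[xS xA]]; exists x.
move=> SA; exfalso.
have {SU} : #|V| ^ m <= #|FF| * (#|V| - L) ^ m.
  apply: leq_trans SU; rewrite leq_pmull // card_gt0; apply/set0Pn.
  by exists A; rewrite inE AFF.
have LV : L <= #|V| by apply: leq_trans (FFL _ AFF) (max_card _).
have FF0 : 0 < #|FF| by rewrite card_gt0; apply/set0Pn; exists A.
have [V0|V0] := posnP #|V|.
  have L0 : L = 0 by lia.
  by move: lnFF; rewrite L0 V0 muln0 mulr0 ltxx.
rewrite -(ler_nat R) natrM !natrX natrB // => le1.
have V0' : (0 < #|V|%:R :> R)%R by rewrite ltr0n.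
have FF0' : (0 < #|FF|%:R :> R)%R by rewrite ltr0n.
have le2 : (#|V|%:R - L%:R <= #|V|%:R * expR (- (L%:R / #|V|%:R)) :> R)%R.
  apply: (@le_trans _ _ (#|V|%:R * (1 + - (L%:R / #|V|%:R)))%R).
    by rewrite mulrDr mulr1 mulrN mulrC divfK ?gt_eqF.
  by rewrite ler_pM2l // expR_ge1Dx.
have le3 : (1 <= #|FF|%:R * expR (- (L%:R / #|V|%:R)) ^+ m :> R)%R.
  rewrite -(ler_pM2l (exprn_gt0 m V0')) mulr1 mulrCA -exprMn.
  apply: le_trans le1 _; rewrite ler_pM2l // lerXn2r // ?nnegrE.
  - by rewrite subr_ge0 ler_nat.
  - by rewrite mulr_ge0 // ?expR_ge0.
have le4 : (m%:R * (L%:R / #|V|%:R) <= ln #|FF|%:R :> R)%R.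
  rewrite -ler_expR lnK ?posrE //.
  by move: le3; rewrite -expRM_natl mulrN expRN ler_pdivlMr ?expR_gt0 // mul1r.
move: lnFF; rewrite ltNge => /negP; apply.
by rewrite natrM -ler_pdivrMr // -mulrA.
Qed.

End Hitting.

(** * Construction of the spanner and count of its edges *)

Lemma card_bigcup_le (I T : finType) (P : pred I) (B : I -> {set T}) (b : nat) :
  (forall i, P i -> #|B i| <= b)%N -> (#|\bigcup_(i | P i) B i| <= #|P| * b)%N.
Proof.
move=> Bb; rewrite -sum_nat_const.
apply: (@leq_trans (\sum_(i | P i) #|B i|)%N); last exact: leq_sum.
elim/big_rec2: _ => [|i n A _ An]; first by rewrite cards0.
by apply: leq_trans (leq_card_setU _ _) _; rewrite leq_add2l.
Qed.

Lemma card_simple_graph (V : finType) (E : {set {set V}}) :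
  simple_graph E -> (#|E| <= 'C(#|V|, 2))%N.
Proof.
move=> simpleE; rewrite -card_draws.
by apply/subset_leq_card/subsetP => e /simpleE e2; rewrite inE e2.
Qed.

Section Construction.
Local Open Scope nat_scope.
Variables (V : finType) (K : eqType) (E : {set {set V}}) (col : {set V} -> K).
Variables (Delta q : nat).
Hypothesis simpleE : simple_graph E.
Hypothesis class_le : forall c, #|color_class E col c| <= Delta.

(** For [j <= Delta], hitting depends on [q ^ j.+1 * L j = q ^ Delta.+2], and the edge count on
    [q ^ j.+1 * L j.+1 = q ^ Delta.+1]; neither varies with [j]. *)
Let L j := q ^ (Delta.+1 - j).

(* The member [E] stands for all colors that occur on no edge. *)
Definition surviving_graphs : {set {set {set V}}} :=
  E |: [set delete_color E col (col e) | e in E].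

Lemma surviving_graphs_mem c : delete_color E col c \in surviving_graphs.
Proof.
have [/hasP[e eE /eqP <-]|/hasPn noc] := boolP (has (fun e => col e == c) (enum E)).
  by apply/setU1P; right; apply: imset_f; rewrite mem_enum in eE.
apply/setU1P; left; apply/setP => e; rewrite delete_colorP.
by case: (boolP (e \in E)) => //= eE; rewrite noc // mem_enum.
Qed.

Definition prefix_set l (p : {set {set V}} * (V * V)) : {set V} :=
  [set x in take l (geodesic p.1 p.2.1 p.2.2)].

Definition to_hit l : {set {set V}} :=
  [set A in [set nbhd p.1 p.2 | p in setX surviving_graphs [set: V]]
         :|: [set prefix_set l p | p in setX surviving_graphs [set: V * V]]
     | l <= #|A|].

(** On [n] vertices there are at most [1 + 'C(n, 2) <= n ^ 2] graphs, each with [n] neighborhoods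
    and [n ^ 2] prefixes. The exponent becomes the factor 5 in [q_large]. *)
Lemma card_to_hit l : 1 < #|V| -> #|to_hit l| <= #|V| ^ 5.
Proof.
move=> V1; have cardS : #|surviving_graphs| <= #|V| ^ 2.
  apply: leq_trans (leq_card_setU _ _) _; rewrite cards1.
  apply: (@leq_trans (1 + 'C(#|V|, 2))).
    rewrite leq_add2l; apply: leq_trans (leq_imset_card _ _) _.
    exact: card_simple_graph.
  rewrite bin2; case: #|V| V1 => // n; rewrite ltnS => n0.
  have := odd_double_half (n.+1 * n).
  rewrite expnS expn1 -addnn; nia.
have : #|to_hit l| <= #|V| ^ 2 * #|V| + #|V| ^ 2 * (#|V| * #|V|).
  apply: (@leq_trans #|[set nbhd p.1 p.2 | p in setX surviving_graphs [set: V]]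
         :|: [set prefix_set l p | p in setX surviving_graphs [set: V * V]]|).
    by apply/subset_leq_card/subsetP => A; rewrite inE => /andP[].
  apply: leq_trans (leq_card_setU _ _) _.
  apply: leq_add; apply: leq_trans (leq_imset_card _ _) _;
    by rewrite cardsX cardsT ?card_prod leq_mul2r cardS orbT.
move=> /leq_trans; apply; rewrite !expnS expn0 muln1; move: #|V| V1 => n n1.
by nia.
Qed.

Variable R : realType.
Hypothesis V_gt1 : 1 < #|V|.
Hypothesis q_gt1 : 1 < q.
Hypothesis q_large : (5%:R * ln #|V|%:R * #|V|%:R < q%:R ^+ Delta.+2 :> R)%R.

Lemma hitting_sets : exists S : nat -> {set V}, forall j, j <= Delta ->
  #|S j| <= q ^ j.+1 /\
  forall A, A \in to_hit (L j) -> exists2 x, x \in S j & x \in A.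
Proof.
suff /choice[S SP] : forall j, exists Sj : {set V}, j <= Delta ->
    #|Sj| <= q ^ j.+1 /\
    forall A, A \in to_hit (L j) -> exists2 x, x \in Sj & x \in A by exists S.
move=> j; have [jD|jD] := leqP j Delta; last by exists set0.
have [||S Sm SA] := @hitting_set V R (to_hit (L j)) (L j) (q ^ j.+1).
- by move=> A; rewrite inE => /andP[].
- rewrite {2}/L -expnD; have -> : j.+1 + (Delta.+1 - j) = Delta.+2 by lia.
  rewrite natrX; apply: le_lt_trans q_large; rewrite ler_pM2r ?ltr0n ?(ltnW V_gt1) //.
  (* For an empty family the convention that [ln] is 0 at 0 applies. *)
  have [->|hit0] := posnP #|to_hit (L j)|.
    by rewrite ln0 // mulr_ge0 // ln_ge0 // ler1n ltnW.
  rewrite mulr_natl -lnXn ?ltr0n ?(ltnW V_gt1) //.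
  by rewrite ler_ln ?posrE ?exprn_gt0 ?ltr0n ?(ltnW V_gt1) // -natrX ler_nat card_to_hit.
- by exists S.
Qed.

Lemma spanner_exists : 0 < Delta -> exists2 H : {set {set V}},
  one_CFT_plus2_spanner R E col H & #|H| <= 6 * Delta * (#|V| * q ^ Delta.+1).
Proof.
move=> D0; have [S S_spec] := hitting_sets.
pose light := [set x | #|nbhd E x| < L 0 + Delta].
pose Hlight := \bigcup_(x in light) [set [set x; y] | y in nbhd E x].
pose Hstep := \bigcup_(j < Delta.+1) \bigcup_(t : V) \bigcup_(s in S j)
  [set e in first_edges E col t s (L j.+1)].
(* An empty geodesic yields the singleton [[set t]] as first edge; intersecting with [E] discards
   it. *)
pose H := Hlight :|: (E :&: Hstep).
have HE : H \subset E.
  apply/subsetP => e /setUP[/bigcupP[x _ /imsetP[y + ->]]|/setIP[]//].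
  by rewrite inE.
exists H.
  apply: (@cluster_one_CFT _ _ E H col (S 0) Delta (L 0)) => //.
  - move=> c x big; apply: (S_spec 0 (leq0n _)).2.
    rewrite inE big andbT; apply/setUP; left; apply/imsetP.
    by exists (delete_color E col c, x); rewrite // inE surviving_graphs_mem inE.
  - move=> x e lx eE xe; apply/setUP; left; apply/bigcupP; exists x; first by rewrite inE.
    have /eqP := simpleE eE; rewrite (cardsD1 x) xe eqSS => /cards1P[y ey].
    have def_e : e = [set x; y] by rewrite -(setD1K xe) ey.
    by apply/imsetP; exists y => //; rewrite inE /adj -def_e.
  - move=> c t s k sS w; apply: (@preserver _ _ E H col Delta S L) w => //.
    + move=> j t' s' c' k' jD w' p Lp.
      have [|x xS] := (S_spec j jD).2 [set x in take (L j) p].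
      * rewrite inE; apply/andP; split.
          apply/setUP; right; apply/imsetP; exists (delete_color E col c', (t', s')) => //.
          by rewrite inE surviving_graphs_mem inE.
        have /andP[_ up] := geodesic_uniq w'.
        by rewrite cardsE (card_uniqP (take_uniq _ up)) size_takel.
      * by rewrite inE => xp; exists x.
    + move=> j t' s' e jD sj et eE; apply/setUP; right; rewrite inE eE /=.
      apply/bigcupP; exists (inord j) => //; apply/bigcupP; exists t' => //.
      by apply/bigcupP; exists s'; rewrite ?inE inordK.
have q0 : 0 < q by apply: ltnW.
have D_le : Delta <= q ^ Delta.+1.
  by apply: leq_trans (ltnW (ltn_expl _ q_gt1)) _; rewrite leq_exp2l.
have light_le : #|Hlight| <= #|V| * (q ^ Delta.+1 + Delta).
  apply: (@leq_trans (#|light| * (q ^ Delta.+1 + Delta))).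
    apply: card_bigcup_le => x; rewrite inE /L subn0 => /ltnW xl.
    by apply: leq_trans xl; exact: leq_imset_card.
  by rewrite leq_mul2r max_card orbT.
have step_le : #|Hstep| <= Delta.+1 * (#|V| * (2 * q ^ Delta.+1)).
  rewrite -{1}(card_ord Delta.+1); apply: card_bigcup_le => j _.
  apply: card_bigcup_le => t _; have jD : j <= Delta by rewrite -ltnS.
  apply: (@leq_trans (#|S j| * (1 + L j.+1))).
    apply: card_bigcup_le => s _.
    rewrite cardsE; apply: leq_trans (card_size _) _; rewrite /= size_map ltnS size_take.
    by case: ltnP.
  have -> : q ^ Delta.+1 = q ^ j.+1 * L j.+1.
    by rewrite /L -expnD; congr (_ ^ _); lia.
  rewrite mulnCA leq_mul ?(S_spec _ jD).1 // mul2n -addnn leq_add2r.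
  by rewrite /L expn_gt0 q0.
have : #|H| <= #|Hlight| + #|Hstep|.
  apply: leq_trans (leq_card_setU _ _) _; rewrite leq_add2l.
  by apply: subset_leq_card; exact: subsetIr.
(* With [Q = q ^ Delta.+1], each vertex accounts for [Q + Delta <= 2 * Q] light edges and
   [2 * Delta.+1 * Q <= 4 * Delta * Q] others, at most [6 * Delta * Q] in total. *)
move: light_le step_le D_le; move: (q ^ Delta.+1) #|Hlight| #|Hstep| #|H| #|V|.
move=> Q a b h n aP bP QD hP; apply: leq_trans hP _.
apply: leq_trans (leq_add aP bP) _.
rewrite (_ : Delta.+1 * (n * (2 * Q)) = n * (Delta.+1 * 2 * Q)); last by lia.
rewrite -mulnDr mulnCA leq_mul2l; apply/orP; right; nia.
Qed.

End Construction.

(** * Estimates of real powers and logarithms *)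

Lemma powS_le (R : realType) (x : R) m : m%:R <= x ->
  (x + 1) ^+ m <= expR 1 * x ^+ m.
Proof.
move=> mx; have [x0|x0] := leP x 0.
  have -> : m = 0%N by apply/eqP; rewrite -leqn0 -(ler_nat R) (le_trans mx).
  by rewrite !expr0 mulr1; have := expR_ge1Dx (1 : R); lra.
(* The lost factor is [(1 + x^-1) ^+ m <= expR (m / x) <= expR 1]. *)
have -> : x + 1 = x * (1 + x^-1) by rewrite mulrDr mulr1 divff ?gt_eqF.
rewrite exprMn mulrC ler_pM2r ?exprn_gt0 //.
apply: (@le_trans _ _ (expR x^-1 ^+ m)).
  by rewrite lerXn2r ?nnegrE ?expR_ge0 ?expR_ge1Dx // addr_ge0 // invr_ge0 ltW.
by rewrite -expRM_natl ler_expR ler_pdivrMr // mul1r.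
Qed.

(** From [1 - 2^-1 <= expR (- 2^-1)] one gets [expR 2^-1 <= 2]. This keeps powers of [ln n] away
    from 0. *)
Lemma ln_ge_half (R : realType) n : (1 < n)%N -> 2^-1 <= ln n%:R :> R.
Proof.
move=> n1; rewrite -ler_expR lnK ?posrE ?ltr0n ?(ltnW n1) //.
apply: (@le_trans _ _ 2); last by rewrite ler_nat.
have := expR_ge1Dx (- 2^-1 : R); rewrite expRN.
have -> : 1 - 2^-1 = 2^-1 :> R by lra.
by rewrite lef_pV2 ?posrE ?expR_gt0.
Qed.

Section Size.
Variables (R : realType) (Delta n : nat).
Hypotheses (D0 : (0 < Delta)%N) (n1 : (1 < n)%N).
Let a : R := (Delta + 2)%:R^-1.
Let M : R := 5%:R * ln n%:R * n%:R.
Let r : R := M `^ a.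

Definition size_bound : R :=
  n%:R `^ (2 - a) * Delta%:R * ln n%:R `^ (1 - a).

Lemma nR_gt0 : 0 < n%:R :> R.
Proof. by rewrite ltr0n ltnW. Qed.

Lemma ln_nR_gt0 : 0 < ln n%:R :> R.
Proof. by apply: lt_le_trans (ln_ge_half R n1); rewrite invr_gt0. Qed.

Lemma a_gt0 : 0 < a.
Proof. by rewrite invr_gt0 ltr0n addn2. Qed.

Lemma a_le1 : a <= 1.
Proof. by rewrite invf_le1 ?ltr0n ?ler1n addn2. Qed.

Lemma M_gt0 : 0 < M.
Proof. by rewrite /M !mulr_gt0 ?ln_nR_gt0 ?nR_gt0. Qed.

Lemma r_exp : r ^+ (Delta + 2) = M.
Proof.
rewrite -powR_mulrn ?powR_ge0 // /r -powRrM mulVf ?powRr1 ?ltW ?M_gt0 //.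
Qed.

(** As [n <= M], [n^a] is at most [r < Delta + 2 <= 3 * Delta], while [(ln n)^(1 - a)] is at least
    1/2; hence the 6. *)
Lemma many_faults_size : r < (Delta + 2)%:R -> n%:R ^+ 2 <= 6%:R * size_bound.
Proof.
move=> rD; have n0 := nR_gt0; have l0 := ln_nR_gt0; have l2 := ln_ge_half R n1.
have na : n%:R `^ a <= 3%:R * Delta%:R.
  apply: (@le_trans _ _ r); last first.
    apply: ltW; apply: lt_le_trans rD _; rewrite -natrM ler_nat; lia.
  apply: ge0_ler_powR; rewrite ?nnegrE ?(ltW a_gt0) ?(ltW M_gt0) ?(ltW n0) //.
  by rewrite /M ler_peMl ?ltW //; lra.
have la : 2^-1 <= ln n%:R `^ (1 - a).
  apply: (@le_trans _ _ (2^-1 `^ (1 - a))).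
    rewrite -{1}[2^-1]powRr1 ?invr_ge0 //; apply: ger_powR.
      by rewrite invr_gt0 ltr0n /= invf_le1 ?ler1n.
    by rewrite gerBl ltW // a_gt0.
  by apply: ge0_ler_powR; rewrite ?subr_ge0 ?a_le1 // ?nnegrE ?invr_ge0 // ltW.
have -> : n%:R ^+ 2 = n%:R `^ (2 - a) * n%:R `^ a :> R.
  by rewrite -powRD ?(gt_eqF n0) ?implybT // subrK powR_mulrn ?ltW.
have -> : 6%:R * size_bound =
    n%:R `^ (2 - a) * (3%:R * Delta%:R * (2 * ln n%:R `^ (1 - a))).
  by rewrite /size_bound; ring.
rewrite ler_pM2l ?powR_gt0 //; apply: le_trans na _.
by rewrite ler_peMr ?mulr_ge0 //; lra.
Qed.

(** Since [(Delta + 1) * a = 1 - a], [r ^+ Delta.+1] is [M^(1 - a)]. The 30 is 6 times the bound 5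
    on [5^(1 - a)], and [expR 1] pays for rounding [r] up to [q]. *)
Lemma few_faults_size : (Delta + 2)%:R <= r ->
  let q := (Num.truncn r).+1 in
  [/\ (1 < q)%N, M < q%:R ^+ Delta.+2 &
   (6 * Delta * (n * q ^ Delta.+1))%:R <= 30%:R * expR 1 * size_bound].
Proof.
move=> Dr q; have n0 := nR_gt0; have l0 := ln_nR_gt0.
have r0 : 0 < r by apply: powR_gt0; exact: M_gt0.
have rq : r < q%:R by exact: truncnS_gt.
split.
- by rewrite -(ltr_nat R); apply: le_lt_trans rq; apply: le_trans Dr; rewrite ler1n addn2.
- by rewrite -r_exp addn2 ltrXn2r ?nnegrE ?ltW.
have qr : q%:R <= r + 1 by rewrite -natr1 lerD2r truncn_le // ltW.
have qD : q%:R ^+ Delta.+1 <= expR 1 * r ^+ Delta.+1.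
  apply: le_trans (powS_le _); last by apply: le_trans Dr; rewrite ler_nat addn2.
  by rewrite lerXn2r ?nnegrE ?addr_ge0 // ltW.
have rD : r ^+ Delta.+1 = M `^ (1 - a).
  rewrite -powR_mulrn ?ltW // /r -powRrM; congr (_ `^ _).
  rewrite /a -natr1; have : (Delta + 2)%:R != 0 :> R by rewrite pnatr_eq0 addn2.
  by rewrite natrD => h; field.
have MD : M `^ (1 - a) <= 5%:R * (ln n%:R `^ (1 - a) * n%:R `^ (1 - a)).
  have -> : M `^ (1 - a) =
      5%:R `^ (1 - a) * (ln n%:R `^ (1 - a) * n%:R `^ (1 - a)).
    by rewrite /M -mulrA !powRM // ?mulr_ge0 // ltW.
  rewrite ler_pM2r ?mulr_gt0 ?powR_gt0 //.
  rewrite -{2}[5%:R]powRr1 //; apply: ler_powR; rewrite ?ler1n // gerBl ltW //.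
  exact: a_gt0.
have n2 : n%:R `^ (2 - a) = n%:R * n%:R `^ (1 - a) :> R.
  have -> : 2 - a = 1 + (1 - a) by lra.
  by rewrite powRD ?powRr1 ?ltW // (gt_eqF n0) implybT.
rewrite !natrM natrX /size_bound n2.
have {qD rD MD} qD : q%:R ^+ Delta.+1 <=
    expR 1 * (5%:R * (ln n%:R `^ (1 - a) * n%:R `^ (1 - a))).
  by apply: le_trans qD _; rewrite ler_pM2l ?expR_gt0 // rD.
have D0' : 0 < Delta%:R :> R by rewrite ltr0n.
apply: (@le_trans _ _ (6%:R * Delta%:R * (n%:R *
    (expR 1 * (5%:R * (ln n%:R `^ (1 - a) * n%:R `^ (1 - a))))))).
  by rewrite ler_pM2l ?mulr_gt0 // ler_pM2l.
rewrite le_eqVlt; apply/orP; left; apply/eqP; ring.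
Qed.

End Size.

Theorem theorem1p4 (R : realType) :
  exists2 C : R, 0 < C &
    forall (Delta n : nat) (V : finType) (K : eqType)
      (E : {set {set V}}) (col : {set V} -> K),
      (1 <= Delta)%N ->
      #|V| = n ->
      simple_graph E ->
      (forall c : K, (#|color_class E col c| <= Delta)%N) ->
      exists2 H : {set {set V}},
        one_CFT_plus2_spanner R E col H &
        #|H|%:R <= C * (n%:R `^ (2 - (Delta + 2)%:R^-1) * Delta%:R *
                        ln n%:R `^ (1 - (Delta + 2)%:R^-1)).
Proof.
(* Dictated by [few_faults_size]; it exceeds the 6 of [many_faults_size]. *)
exists (30%:R * expR 1); first by rewrite mulr_gt0 ?expR_gt0.
move=> Delta n V K E col D0 <- simpleE class_le {n}.
suff : exists2 H : {set {set V}}, one_CFT_plus2_spanner R E col H &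
  #|H|%:R <= 30%:R * expR 1 * size_bound R Delta #|V| by [].
have E_spanner : one_CFT_plus2_spanner R E col E.
  by split=> // c u v; rewrite leeDl // lee_fin.
have E_le : (#|E| <= 'C(#|V|, 2))%N by exact: card_simple_graph.
have B0 : 0 <= size_bound R Delta #|V|.
  by rewrite /size_bound !mulr_ge0 ?powR_ge0.
have e1 : 1 <= expR 1 :> R by have := expR_ge1Dx (1 : R); lra.
(* With at most one vertex the bound is 0, since [ln] is, but then there are no edges either. *)
have [V1|V1] := leqP #|V| 1.
  exists E => //; move: E_le; rewrite bin_small ?ltnS // leqn0 => /eqP ->.
  by rewrite mulr_ge0 // mulr_ge0 ?expR_ge0.
have [rD|Dr] := ltP ((5%:R * ln #|V|%:R * #|V|%:R) `^ (Delta + 2)%:R^-1 : R)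
  (Delta + 2)%:R.
  exists E => //; apply: (@le_trans _ _ (#|V|%:R ^+ 2)).
    rewrite -natrX ler_nat; apply: leq_trans E_le _.
    by rewrite bin2 -[leqRHS]doubleK leq_half_double; nia.
  apply: le_trans (many_faults_size D0 V1 rD) _; apply: ler_wpM2r => //; lra.
have [q1 qM qB] := few_faults_size D0 V1 Dr.
have [H HS HB] := spanner_exists simpleE class_le V1 q1 qM D0.
by exists H => //; apply: le_trans qB; rewrite ler_nat.
Qed.
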